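(* Suppose that (D) is feasible and that at each step of the Generic Facial Reduction algorithm the direction $d_i$ is selected such that $$d_i \in \mathrm{ri}\left(\mathcal{F}_i^*\cap \ker \mathcal{A} \cap \{c\}^\perp\right).$$ Then the algorithm will output exactly $d(D)$ directions.
   Context: Let $\mathcal{K}\subseteq\mathbb{R}^n$ be a closed convex cone, $\mathcal{A}:\mathbb{R}^n\to\mathbb{R}^m$ linear with adjoint $\mathcal{A}^*$, $b\in\mathbb{R}^m$, $c\in\mathbb{R}^n$; a star on a cone denotes the dual cone, $\mathrm{ri}$ the relative interior. Problem (D) is $\sup\{\langle b,y\rangle : c-\mathcal{A}^*y\in\mathcal{K}\}$, and $\mathcal{F}_{\min}^D$ is the minimal face of $\mathcal{K}$ containing the feasible slacks $\{c-\mathcal{A}^*y\in\mathcal{K}\}$. Generic Facial Reduction: (1) Set $\mathcal{F}_1=\mathcal{K}$, $i=1$. (2) Let $d_i\in\mathcal{F}_i^*\cap\ker\mathcal{A}$ be such that either (i) $d_i\notin\mathcal{F}_i^\perp$ and $\langle c,d_i\rangle=0$, or (ii) $\langle c,d_i\rangle<0$; if no such $d_i$ exists, set $\mathcal{F}_{\min}^D=\mathcal{F}_i$ and stop. (3) If $\langle c,d_i\rangle<0$, set $\mathcal{F}_{\min}^D=\emptyset$ and stop. (4) If $\langle c,d_i\rangle=0$, set $\mathcal{F}_{i+1}=\mathcal{F}_i\cap\{d_i\}^\perp$, increase $i$ by one, and return to (2). The output is the set of all directions found, together with $\mathcal{F}_{\min}^D$. The singularity degree $d(D)$ is the minimum number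 of directions among all possible outputs. The selection rule in the claim applies whenever a direction is chosen in Step 2(i). *)

(* Defs.v *)
From HB Require Import structures.
From mathcomp Require Import all_boot all_order all_algebra finmap.
From mathcomp Require Import all_classical all_reals all_analysis.

Set Implicit Arguments.
Unset Strict Implicit.
Unset Printing Implicit Defensive.

Import Order.TTheory GRing.Theory Num.Theory.
Import numFieldNormedType.Exports.

Local Open Scope classical_set_scope.
Local Open Scope ring_scope.

Section ConvexGeometry.
Variables (R : realType) (n : nat).
Implicit Types (C F K : set 'rV[R]_n) (x y d : 'rV[R]_n).

(* R^n is 'rV[R]_n, with the product topology. *)
Definition dot x y : R := \sum_(i < n) x 0 i * y 0 i.

Definition is_convex_cone K : Prop :=
  [/\ K !=set0,
      convex_set (K : set (convex_lmodType 'rV[R]_n)) &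
      forall (a : R) x, 0 <= a -> K x -> K (a *: x)].

Definition dual_cone F : set 'rV[R]_n := [set d | forall x, F x -> 0 <= dot x d].

Definition orth F : set 'rV[R]_n := [set d | forall x, F x -> dot x d = 0].

Definition is_affine C : Prop :=
  forall (t : R) x y, C x -> C y -> C ((1 - t) *: x + t *: y).

Definition affine_hull C : set 'rV[R]_n := smallest is_affine C.

(* Interior of C for the topology induced on its affine hull. *)
Definition relint C : set 'rV[R]_n :=
  [set x | C x /\ within (affine_hull C) (nbhs x) C].

End ConvexGeometry.

Definition is_adjoint (R : realType) (n m : nat)
    (A : {linear 'rV[R]_n -> 'rV[R]_m})
    (Astar : {linear 'rV[R]_m -> 'rV[R]_n}) : Prop :=
  forall x y, dot (A x) y = dot x (Astar y).

Definition D_feasible (R : realType) (n m : nat) (K : set 'rV[R]_n)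
    (Astar : {linear 'rV[R]_m -> 'rV[R]_n}) (c : 'rV[R]_n) : Prop :=
  exists y : 'rV[R]_m, K (c - Astar y).

Section FacialReduction.
Variables (R : realType) (n m : nat) (K : set 'rV[R]_n).
Variables (A : {linear 'rV[R]_n -> 'rV[R]_m}) (c : 'rV[R]_n).
Implicit Types (F : set 'rV[R]_n) (D : {fset 'rV[R]_n}) (d : 'rV[R]_n).

Definition ker_lin : set 'rV[R]_n := [set x | A x = 0].

Definition step_i F d : Prop :=
  [/\ (dual_cone F `&` ker_lin) d, ~ orth F d & dot c d = 0].

Definition step_ii F d : Prop :=
  (dual_cone F `&` ker_lin) d /\ dot c d < 0.

(* A selection rule restricts the directions that may be chosen in step (i):
   [rule F d] allows [d] when the current face is [F]. *)
Definition selection_rule := set 'rV[R]_n -> set 'rV[R]_n.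

Definition any_rule : selection_rule := fun _ => setT.

Definition ri_rule : selection_rule := fun F =>
  relint (dual_cone F `&` ker_lin `&` orth [set c]).

(* [fr_reach rule D F]: some execution following [rule] is at the start of
   step (2) with current face [F], having found so far the directions in [D]. *)
Inductive fr_reach (rule : selection_rule) :
    {fset 'rV[R]_n} -> set 'rV[R]_n -> Prop :=
| fr_start : fr_reach rule fset0 K
| fr_step D F d : fr_reach rule D F -> step_i F d -> rule F d ->
    fr_reach rule (d |` D)%fset (F `&` orth [set d]).

Definition fr_stop F : Prop := forall d, ~ step_i F d /\ ~ step_ii F d.

(* [fr_output rule D F]: some execution following [rule] terminates with the
   set of directions [D] and returns [F] as the minimal face. *)
Inductive fr_output (rule : selection_rule) :
    {fset 'rV[R]_n} -> set 'rV[R]_n -> Prop :=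
| fr_out_face D F : fr_reach rule D F -> fr_stop F -> fr_output rule D F
| fr_out_empty D F d : fr_reach rule D F -> step_ii F d ->
    fr_output rule (d |` D)%fset set0.

Definition fr_num_directions (rule : selection_rule) : set nat :=
  [set k | exists D F, fr_output rule D F /\ #|` D|%fset = k].

(* The default value 0 is used only if there is no output. *)
Definition singularity_degree : nat :=
  xget 0%N [set k | fr_num_directions any_rule k /\
                    forall l, fr_num_directions any_rule l -> (k <= l)%N].

(* At every reachable point where the algorithm does not stop, [rule] leaves
   at least one direction to choose. *)
Definition fr_progress (rule : selection_rule) : Prop :=
  forall D F, fr_reach rule D F -> ~ fr_stop F ->
    exists d, step_i F d /\ rule F d \/ step_ii F d.

(* Every execution following [rule] is finite. *)
Definition fr_terminates (rule : selection_rule) : Prop :=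
  ~ exists (F : nat -> set 'rV[R]_n) (d : nat -> 'rV[R]_n),
      F 0%N = K /\
      forall i, [/\ step_i (F i) (d i), rule (F i) (d i) &
                    F i.+1 = F i `&` orth [set d i]].

End FacialReduction.

(* Main.v *)
Require Import Defs.
From mathcomp Require Import all_boot all_order all_algebra finmap.
From mathcomp Require Import all_classical all_reals all_analysis.
Set Implicit Arguments.
Unset Strict Implicit.
Unset Printing Implicit Defensive.
Import Order.TTheory GRing.Theory Num.Theory.
Import numFieldNormedType.Exports.
Local Open Scope classical_set_scope.
Local Open Scope ring_scope.

(** Write W(F) for the cone F^* ∩ ker A ∩ {c}^⊥, which is antitone in F. If d is
    in ri W(F) and d' is any element of W(F), then d - ε d' is in W(F) for a
    small ε > 0, so that F ∩ d^⊥ ⊆ F ∩ d'^⊥: a relative interior direction cuts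
    at least as deep as any other. By antitonicity of W, the k-th face of the
    ri execution is therefore contained in the k-th face of every other
    execution. Conversely, if an execution stops at a face G, then every
    direction chosen in any execution lies in W(G) ⊆ G^⊥, so G is contained in
    every reachable face. Hence the ri execution has stopped after at most as
    many steps as any other one. *)

(** * Bilinearity of the inner product and orthogonal complements *)

Section Dot.
Variables (R : realType) (n : nat).
Implicit Types (F W : set 'rV[R]_n) (x y z d : 'rV[R]_n) (a : R).

Lemma dotC x y : dot x y = dot y x.
Proof. by apply: eq_bigr => i _; rewrite mulrC. Qed.

Lemma dotDr x y z : dot x (y + z) = dot x y + dot x z.
Proof.
by rewrite /dot -big_split; apply: eq_bigr => i _; rewrite mxE mulrDr.
Qed.

Lemma dotZr x a y : dot x (a *: y) = a * dot x y.
Proof.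
by rewrite /dot mulr_sumr; apply: eq_bigr => i _; rewrite mxE mulrCA.
Qed.

Lemma dot0r x : dot x 0 = 0.
Proof. by rewrite -(scale0r 0) dotZr mul0r. Qed.

Lemma dotBl x y z : dot (x - y) z = dot x z - dot y z.
Proof. by rewrite dotC dotDr -scaleN1r dotZr mulN1r !(dotC z). Qed.

Lemma orth0 F : orth F 0.
Proof. by move=> x _; rewrite dot0r. Qed.

Lemma orthD F d e : orth F d -> orth F e -> orth F (d + e).
Proof. by move=> Fd Fe x Fx; rewrite dotDr Fd // Fe // addr0. Qed.

Lemma orthZ F a d : orth F d -> orth F (a *: d).
Proof. by move=> Fd x Fx; rewrite dotZr Fd // mulr0. Qed.

Lemma orth_set1 d x : orth [set d] x <-> dot x d = 0.
Proof. by split=> [/(_ d erefl)|xd _ ->]; rewrite dotC. Qed.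

Lemma dual_coneS F G : F `<=` G -> dual_cone G `<=` dual_cone F.
Proof. by move=> FG d Gd x /FG /Gd. Qed.

Lemma orthS F G : F `<=` G -> orth G `<=` orth F.
Proof. by move=> FG d Gd x /FG /Gd. Qed.

End Dot.

(** * Relative interiors of convex cones *)

Section RelativeInterior.
Variables (R : realType) (n : nat).
Implicit Types (W : set 'rV[R]_n) (x y d : 'rV[R]_n).

Lemma affine_hull_line W x y (t : R) :
  W x -> W y -> affine_hull W ((1 - t) *: x + t *: y).
Proof. by move=> Wx Wy U [Uaff WU]; apply: Uaff; exact: WU. Qed.

(** The line through [d] and [d + d'] lies in the affine hull of [W], so a short move from [d]
    backwards along it stays in [W]. *)
Lemma relint_sub_dir W d d' : (forall x y, W x -> W y -> W (x + y)) ->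
  relint W d -> W d' -> exists2 e : R, 0 < e & W (d - e *: d').
Proof.
move=> WD [Wd dW] Wd'.
have : (fun e : R => d - e *: d') @ 0^'+ --> d.
  rewrite -[X in _ --> X](subr0 d) -[X in _ - X](scale0r d').
  apply: cvg_at_right_filter; apply: cvgB; first exact: cvg_cst.
  by apply: cvgZr_tmp; exact: cvg_id.
move=> /(_ _ dW) dW'.
near (0 : R)^'+ => e; exists e => //.
have /(_ _) : affine_hull W (d - e *: d') -> W (d - e *: d') by near: e.
(* [d - e *: d'] is the affine combination of [d] and [d + d'] with parameter [- e]. *)
apply; have := @affine_hull_line W d (d + d') (- e) Wd (WD _ _ Wd Wd').
by rewrite opprK scalerDl scale1r scalerDr !scaleNr addrA addrK.
Unshelve. all: by end_near. Qed.

Lemma linear_functional_continuous (f : {linear 'rV[R]_n -> R^o}) :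
  continuous (f : 'rV[R]_n -> R).
Proof.
have -> : (f : 'rV[R]_n -> R) = fun x => \sum_j x 0 j * f (delta_mx 0 j).
  apply/funext => x; rewrite {1}(row_sum_delta x) linear_sum.
  by apply: eq_bigr => j _; rewrite linearZ.
apply: continuous_big => [|j _ x]; first exact: add_continuous.
apply: (@cvgMr_tmp _ _ (nbhs x)); exact: coord_continuous.
Qed.

(** Take a free sequence in [W] of maximal length: a vector of [W] outside its span would extend
    it. *)
Lemma spanning_free_seq W : exists X : seq 'rV[R]_n,
  [/\ free X, forall x, x \in X -> W x & forall x, W x -> x \in <<X>>%VS].
Proof.
pose P k := `[< exists X : seq 'rV[R]_n,
  [/\ size X = k, free X & forall x, x \in X -> W x] >].
have P0 : exists k, P k by exists 0%N; apply/asboolP; exists [::]; rewrite nil_free.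
have Pub k : P k -> (k <= \dim {:'rV[R]_n})%N.
  by move=> /asboolP[X [<- /eqP <- _]]; rewrite dimvS ?subvf.
have [k /asboolP[X [Xk Xfree XW]] kmax] := ex_maxnP P0 Pub.
exists X; split=> // x Wx; apply: contrapT => /negP xX.
suff /kmax : P k.+1 by rewrite ltnn.
apply/asboolP; exists (x :: X); split; first by rewrite /= Xk.
  by rewrite free_cons xX.
by move=> y; rewrite in_cons => /orP[/eqP ->|/XW].
Qed.

(** The witness is the sum [d] of a basis of the span drawn from [W]. Its coordinates are all 1, so
    they stay positive nearby, and a point of the span with nonnegative coordinates is in the
    cone. *)
Lemma relint_cone_nonempty W : W 0 -> (forall x y, W x -> W y -> W (x + y)) ->
  (forall (a : R) x, 0 <= a -> W x -> W (a *: x)) -> relint W !=set0.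
Proof.
move=> W0 WD WZ; have [X [Xfree XW WX]] := spanning_free_seq W.
pose XT := in_tuple X; pose d : 'rV[R]_n := \sum_(i < size X) X`_i.
have Wcomb (k : 'I_(size X) -> R) : (forall i, 0 <= k i) ->
    W (\sum_i k i *: X`_i).
  move=> k0; elim/big_ind: _ => // i _.
  by apply: WZ => //; apply: XW; rewrite mem_nth.
have Wd : W d.
  have := Wcomb (fun=> 1) (fun=> ler01).
  by under eq_bigr do rewrite scale1r.
exists d; split => //.
(* The span is an affine set containing [W]. *)
have hullX : affine_hull W `<=` [set x | x \in <<X>>%VS].
  by apply: smallest_sub => // t x y /= xX yX; rewrite rpredD ?rpredZ.
have : \forall y \near d, forall i, 0 < coord XT i y.
  apply: (@filter_forall _ _ _ (nbhs d)) => i.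
  have coord_d : coord XT i d = 1.
    have := @coord_sum_free _ _ _ XT (fun=> 1) i Xfree.
    by under eq_bigr do rewrite scale1r.
  have /cvgr_gt : (coord XT i : _ -> R) @ d --> (1 : R).
    by rewrite -coord_d; exact: linear_functional_continuous.
  exact.
apply: filterS => y y_gt0 /hullX /(@coord_span _ _ _ XT) ->.
by apply: Wcomb => i; exact: ltW.
Qed.

End RelativeInterior.

(** * Comparison of executions of facial reduction *)

Section FacialReduction.
Variables (R : realType) (n m : nat) (K : set 'rV[R]_n).
Variables (A : {linear 'rV[R]_n -> 'rV[R]_m}) (c : 'rV[R]_n).
Implicit Types (F G : set 'rV[R]_n) (D : {fset 'rV[R]_n}) (d s : 'rV[R]_n).

Definition step_cone F := dual_cone F `&` ker_lin A `&` orth [set c].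

Lemma step_coneS F G : F `<=` G -> step_cone G `<=` step_cone F.
Proof. by move=> FG d [[/(dual_coneS FG) ? ?] ?]. Qed.

Lemma step_cone0 F : step_cone F 0.
Proof.
split; last exact: orth0.
by split=> [x _|]; [rewrite dot0r|exact: linear0].
Qed.

Lemma step_coneD F d d' :
  step_cone F d -> step_cone F d' -> step_cone F (d + d').
Proof.
move=> [[Fd Ad] cd] [[Fd' Ad'] cd']; split; last exact: orthD.
split=> [x Fx|]; first by rewrite dotDr addr_ge0 ?Fd ?Fd'.
by rewrite /ker_lin /= linearD Ad Ad' addr0.
Qed.

Lemma step_coneZ F (a : R) d : 0 <= a -> step_cone F d -> step_cone F (a *: d).
Proof.
move=> a0 [[Fd Ad] cd]; split; last exact: orthZ.
split=> [x Fx|]; first by rewrite dotZr mulr_ge0 ?Fd.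
by rewrite /ker_lin /= linearZ /= Ad scaler0.
Qed.

Lemma step_iE F d : step_i A c F d <-> step_cone F d /\ ~ orth F d.
Proof.
split=> [[Fd nFd cd]|[[Fd /(_ c erefl) cd] nFd]] //.
by split=> //; split=> // _ ->.
Qed.

(** For [x] in [F] orthogonal to [d], pairing with [d - e *: d'] shows that [dot x d'] is at most 0,
    while [d'] in the dual cone gives the reverse inequality. *)
Lemma ri_rule_min F d d' : ri_rule A c F d -> step_cone F d' ->
  F `&` orth [set d] `<=` orth [set d'].
Proof.
move=> ri_d Fd' x [Fx /orth_set1 xd]; apply/orth_set1.
have [e e0 [[/(_ x Fx) + _] _]] := relint_sub_dir (@step_coneD F) ri_d Fd'.
rewrite -scaleNr dotDr dotZr xd add0r mulNr oppr_ge0 pmulr_rle0 // => xd'.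
by apply/le_anti; rewrite xd'; case: Fd' => -[+ _] _ => /(_ _ Fx) ->.
Qed.

Lemma ri_rule_step F : ~ fr_stop A c F ->
  exists d, step_i A c F d /\ ri_rule A c F d \/ step_ii A c F d.
Proof.
move=> nstop.
have [d' [/step_iE[Fd' nFd']|step_ii_d']] :
    exists d', step_i A c F d' \/ step_ii A c F d'; last 1 first.
- by exists d'; right.
- apply: contrapT => no; apply: nstop => d.
  by split=> ?; apply: no; exists d; [left|right].
have [d ri_d] := relint_cone_nonempty (step_cone0 F) (@step_coneD F) (@step_coneZ F).
exists d; left; split => //; apply/step_iE; split; first by case: ri_d.
(* If [d] were orthogonal to all of [F], so would be every element of the step cone, including
   [d']. *)
move=> Fd; apply: nFd' => x Fx; apply/orth_set1.
by apply: (ri_rule_min ri_d Fd'); split => //; apply/orth_set1/Fd.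
Qed.

Lemma fr_reach_sub rule D F : fr_reach K A c rule D F -> F `<=` K.
Proof. by elim=> {D F} [|D F d _ FK _ _] // x [/FK]. Qed.

Lemma fr_reach_any rule D F :
  fr_reach K A c rule D F -> fr_reach K A c (@any_rule R n) D F.
Proof. by elim=> {D F} *; [exact: fr_start|exact: fr_step]. Qed.

Lemma fr_reach_orth rule D F d : fr_reach K A c rule D F -> d \in D -> orth F d.
Proof.
move=> reachF; elim: reachF d => {D F} [d|D F e _ IH _ _ d]; first by rewrite inE.
rewrite !inE => /orP[/eqP ->|/IH Fd]; first by move=> x [_ /orth_set1].
by apply: orthS Fd => x [].
Qed.

(** Earlier directions are orthogonal to the current face, so a new one never repeats them: the size
    of the output set counts the steps. *)
Lemma card_fr_step rule D F d : fr_reach K A c rule D F -> step_i A c F d ->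
  #|` d |` D|%fset = #|` D|%fset.+1.
Proof.
move=> reachF [_ nFd _]; rewrite cardfsU1.
by case: (boolP (d \in D)) => // /(fr_reach_orth reachF).
Qed.

(** Induction peels the last step off both executions; the inequality also covers an ri execution
    that is ahead of the other. *)
Lemma ri_reach_min D F D' F' : fr_reach K A c (ri_rule A c) D F ->
  fr_reach K A c (@any_rule R n) D' F' -> (#|` D'| <= #|` D|)%fset%N ->
  F `<=` F'.
Proof.
move=> reachF; elim: reachF D' F' => {D F} [|D F d reachF IH stepd ri_d] D' F'.
  case=> {D' F'} [_ //|D' F' d' reachF' stepd' _].
  by rewrite (card_fr_step reachF' stepd') cardfs0.
case=> {D' F'} [_ x [/(fr_reach_sub reachF)] //|D' F' d' reachF' stepd' _].
rewrite (card_fr_step reachF' stepd') (card_fr_step reachF stepd) ltnS.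
move=> /(IH _ _ reachF') FF' x xF; split; first by apply: FF'; case: xF.
by apply: (ri_rule_min ri_d) xF; apply: step_coneS FF' _ _; case/step_iE: stepd'.
Qed.

(** A direction chosen at a face containing [G] and not orthogonal to [G] would still be a valid
    step at [G]. *)
Lemma fr_stop_min rule D F rule' D' G : fr_reach K A c rule D F ->
  fr_reach K A c rule' D' G -> fr_stop A c G -> G `<=` F.
Proof.
move=> reachF /fr_reach_sub GK stopG.
elim: reachF => {D F} [|D F d _ GF /step_iE[Fd _] _] // x Gx.
split; first exact: GF.
apply/orth_set1; apply: contrapT => xd; have [+ _] := stopG d; apply.
by apply/step_iE; split; [exact: step_coneS Fd|move=> /(_ x Gx)].
Qed.

Lemma ri_reach_le D F D' G : fr_reach K A c (ri_rule A c) D F ->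
  fr_reach K A c (@any_rule R n) D' G -> fr_stop A c G ->
  (#|` D| <= #|` D'|)%fset%N.
Proof.
move=> reachF reachG stopG; case: reachF => {D F} [|D F d reachF stepd _].
  by rewrite cardfs0.
rewrite (card_fr_step reachF stepd) ltnNge; apply/negP => D'D.
(* If the ri execution took more steps, its face [F] before the last one would already equal [G],
   where no step is possible. *)
have FG : F = G.
  apply/seteqP; split; first exact: ri_reach_min D'D.
  exact: (fr_stop_min reachF reachG).
by rewrite FG in stepd; case: (stopG d).
Qed.

(* Each new direction lies outside the span of the previous ones, since those
   are orthogonal to the current face. *)
Lemma fr_terminates_any rule : fr_terminates K A c rule.
Proof.
move=> [F [d [_ Fd]]].
have chain i : exists2 U : {vspace 'rV[R]_n},
    (i <= \dim U)%N & forall u, u \in U -> orth (F i) u.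
  elim: i => [|i [U iU UF]].
    by exists 0%VS => // u; rewrite memv0 => /eqP ->; exact: orth0.
  have [stepd _ FS] := Fd i; exists (U + <[d i]>)%VS.
    apply: leq_ltn_trans iU _; rewrite (ltn_leqif (dimv_leqif_sup (addvSl _ _))).
    rewrite subv_add subvv /= -memvE; apply/negP => /UF.
    by case: stepd.
  move=> _ /memv_addP[u Uu [_ /vlineP[a ->] ->]]; rewrite FS.
  apply: orthD; first by apply: orthS (UF u Uu) => x [].
  by apply: orthZ => x [_ /orth_set1].
have [U] := chain (\dim {:'rV[R]_n}).+1.
by rewrite ltnNge dimvS ?subvf.
Qed.

End FacialReduction.

(** * Feasible problems and the singularity degree *)

Section Feasible.
Variables (R : realType) (n m : nat) (K : set 'rV[R]_n).
Variables (A : {linear 'rV[R]_n -> 'rV[R]_m}).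
Variables (Astar : {linear 'rV[R]_m -> 'rV[R]_n}) (c : 'rV[R]_n).
Hypotheses (adjA : is_adjoint A Astar) (feas : D_feasible K Astar c).

Lemma dot_slack y d : ker_lin A d -> dot (c - Astar y) d = dot c d.
Proof.
by move=> Ad; rewrite dotBl (dotC (Astar y)) -adjA Ad (dotC 0) dot0r subr0.
Qed.

(** A feasible slack pairs with kernel directions as [c] does, so it survives every cut and forces
    [dot c d] to be nonnegative. *)
Lemma feasible_no_step_ii rule D F d :
  fr_reach K A c rule D F -> ~ step_ii A c F d.
Proof.
have [y Ky] := feas; move=> reachF [[Fd Ad]]; rewrite -(dot_slack y Ad).
apply/negP; rewrite -leNgt; apply: Fd.
elim: reachF => {F D} // D F e _ Fy [[_ Ae] _ ce] _.
by split => //; apply/orth_set1; rewrite dot_slack.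
Qed.

Lemma feasible_output rule D F :
  fr_output K A c rule D F -> fr_reach K A c rule D F /\ fr_stop A c F.
Proof. by case=> // D' F' d reachF' /(feasible_no_step_ii reachF'). Qed.

Lemma ri_output_singularity_degree D F :
  fr_output K A c (ri_rule A c) D F -> #|` D|%fset = singularity_degree K A c.
Proof.
move=> /feasible_output[reachF stopF].
have Dle l : fr_num_directions K A c (@any_rule R n) l -> (#|` D|%fset <= l)%N.
  move=> [D' [G [/feasible_output[reachG stopG] <-]]].
  exact: ri_reach_le reachF reachG stopG.
have Dnum : fr_num_directions K A c (@any_rule R n) #|` D|%fset.
  exists D, F; split => //; apply: fr_out_face stopF.
  exact: fr_reach_any reachF.
(* The cardinality of [D] attains the minimum, so the default value of [xget] never occurs. *)
rewrite /singularity_degree; case: xgetP => [k _ [knum kle]|/(_ #|` D|%fset)].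
  by apply/anti_leq; rewrite Dle //= kle.
by case; split.
Qed.

End Feasible.

Theorem proposition13 (R : realType) (n m : nat) (K : set 'rV[R]_n)
    (A : {linear 'rV[R]_n -> 'rV[R]_m})
    (Astar : {linear 'rV[R]_m -> 'rV[R]_n})
    (b : 'rV[R]_m) (c : 'rV[R]_n) :
  is_convex_cone K -> closed K -> is_adjoint A Astar ->
  D_feasible K Astar c ->
  [/\ fr_terminates K A c (ri_rule A c),
      fr_progress K A c (ri_rule A c) &
      forall (D : {fset 'rV[R]_n}) (F : set 'rV[R]_n),
        fr_output K A c (ri_rule A c) D F ->
        #|` D|%fset = singularity_degree K A c].
Proof.
move=> _ _ adjA feas; split.
- exact: fr_terminates_any.
- by move=> D F _; exact: ri_rule_step.
- exact: ri_output_singularity_degree adjA feas.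
Qed.
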